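(* In the setting of the context, let the precoders be those of the local zero-forcing (LZF) scheme: $$\bar{\mathbf w}_{si}=\big[\bar{\mathbf G}_s(\bar{\mathbf G}_s^H\bar{\mathbf G}_s)^{-1}\big]_{(:,i)},\qquad \tilde{\mathbf w}_{sj}=\big[\tilde{\mathbf G}_s(\tilde{\mathbf G}_s^H\tilde{\mathbf G}_s)^{-1}\big]_{(:,j)},$$ where, if subarray $s$ serves a single user, the LZF precoder at subarray $s$ reduces to the maximum ratio transmission (MRT) precoder, i.e. $\bar{\mathbf w}_{si}=\bar{\mathbf g}_{si}$ if that single user is the near-field user $i$, and $\tilde{\mathbf w}_{sj}=\tilde{\mathbf g}_{sj}$ if it is the far-field user $j$. Then the spectral efficiency $\widetilde{\mathrm{SE}}_k$ of far-field user $k\in\mathcal{K_F}$ is $\widetilde{\mathrm{SE}}_k=\log_2(1+\widetilde{\mathrm{SINR}}_k)$ with $$\widetilde{\mathrm{SINR}}_k=\frac{P_f\Big(\sum_{s\in\tilde{\mathcal S}_k}\sqrt{\tilde\eta_{sk}}\Big)^2}{\tilde\Delta+\sigma_k^2},$$ $$\tilde\Delta=P_f\sum_{j\in\mathcal{K_F}\setminus\{k\}}\mathbb E\Big\{\Big|\sum_{s\in\tilde{\mathcal S}_j}\sqrt{\tilde\eta_{sj}}\,\tilde{\mathbf g}_{sk}^H\tilde{\mathbf w}_{sj}\Big|^2\Big\}+P_n\sum_{i\in\mathcal{K_N}}\sum_{s\in\bar{\mathcal S}_i}\sum_{s'\in\bar{\mathcal S}_i}\sqrt{\bar\eta_{si}\bar\eta_{s'i}}\,\bar\tau_{ki}^{ss'},$$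 where $$\bar\tau_{ki}^{ss'}=\Re\big\{\bar{\mathbf w}_{s'i}^H\,\mathbf B_{ki}^{ss'}\,\bar{\mathbf w}_{si}\big\},\qquad \mathbf B_{ki}^{ss'}=\alpha_2^2\bar{\mathbf H}_{2,s'}^H\mathbf M_{kk}\bar{\mathbf H}_{2,s}+\delta_{ss'}\varsigma_k\beta_2^2N\,\mathbf I_{M^\ast},\qquad \mathbf M_{kk}=\boldsymbol\Theta^H\mathbf h_k\mathbf h_k^H\boldsymbol\Theta .$$
   Context: Array and users. A base-station planar array has $M=M_xM_y$ antennas ($M_x,M_y$ odd), spacing $d=\lambda/2$, wavelength $\lambda>0$, partitioned into $S$ subarrays of $M^\ast=M/S$ antennas each; subarray $s\in\mathcal S=\{1,\dots,S\}$ consists of the antennas with indices $r_s=\{(s-1)M^\ast+1,\dots,sM^\ast\}$. Near-field users: $\mathcal{K_N}=\{1,\dots,K_n\}$; far-field users: $\mathcal{K_F}=\{1,\dots,K_f\}$. A reconfigurable intelligent surface (RIS) has $N=N_1N_2$ elements and fixed phase matrix $\boldsymbol\Theta=\mathrm{diag}(e^{j\theta_1},\dots,e^{j\theta_N})$, $\theta_n\in[0,2\pi)$ real. Near-field channels (deterministic, line of sight). Antenna $m$ has coordinates $(m_xd,m_yd,0)$ with $m_x=-\frac{M_x-1}{2}+((m-1)\bmod M_x)$, $m_y=\frac{M_y-1}{2}-\lfloor (m-1)/M_x\rfloor$. User $k\in\mathcal{K_N}$ is at $(u_{k,x},u_{k,y},u_{k,z})$, $u_{k,z}>0$. Put $r_{m,k}=\sqrt{(u_{k,x}-m_xd)^2+(u_{k,y}-m_yd)^2+u_{k,z}^2}$,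 and $\bar g_{m,k}=\sqrt{\frac{A}{4\pi}\frac{u_{k,z}((u_{k,x}-m_xd)^2+u_{k,z}^2)}{r_{m,k}^5}}\;e^{-j2\pi r_{m,k}/\lambda}$ with $A=\lambda^2/(4\pi)$. The channel of subarray $s$ to user $k$ is $\bar{\mathbf g}_{sk}=[\bar g_{m,k}]_{m\in r_s}\in\mathbb C^{M^\ast}$, and $\bar{\mathbf G}_s=[\bar{\mathbf g}_{s1},\dots,\bar{\mathbf g}_{sK_n}]\in\mathbb C^{M^\ast\times K_n}$. Far-field channels. The array-to-RIS channel is $\mathbf H_2=\alpha_2\bar{\mathbf H}_2+\beta_2\tilde{\mathbf H}_2\in\mathbb C^{N\times M}$, where $\alpha_2=\sqrt{\iota\zeta/(\iota+1)}$, $\beta_2=\sqrt{\zeta/(\iota+1)}$ with $\iota\geq 0,\zeta>0$; $\bar{\mathbf H}_2=\mathbf b_N(\varphi^a,\varphi^e)\mathbf a_M(\phi^a,\phi^e)^H$ is deterministic, and $\tilde{\mathbf H}_2$ has i.i.d. $\mathcal{CN}(0,1)$ (circularly symmetric) entries. Here, with fixed real angles, $\mathbf a_M(\phi^a,\phi^e)=[e^{j2\pi m d\cos\phi^e\sin\phi^a/\lambda}]_{m=0}^{M_x-1}\otimes[e^{j2\pi m d\sin\phi^e/\lambda}]_{m=0}^{M_y-1}$ and $\mathbf b_N(\varphi^a,\varphi^e)=[e^{j2\pi n d_R\cos\varphi^e\sin\varphi^a/\lambda}]_{n=0}^{N_1-1}\otimes[e^{j2\pi n d_R\sin\varphi^e/\lambda}]_{n=0}^{N_2-1}$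 (column vectors), $d_R=\lambda/2$. $\mathbf H_{2,s},\bar{\mathbf H}_{2,s}\in\mathbb C^{N\times M^\ast}$ are the submatrices of $\mathbf H_2,\bar{\mathbf H}_2$ with columns $r_s$. The RIS-to-user channel of $k\in\mathcal{K_F}$ is $\mathbf h_k=\sqrt{\varsigma_k}\,\mathbf b_N(\vartheta_k^a,\vartheta_k^e)\in\mathbb C^N$, $\varsigma_k>0$; the cascaded channel from subarray $s$ is $\tilde{\mathbf g}_{sk}^H=\mathbf h_k^H\boldsymbol\Theta\mathbf H_{2,s}$, and $\tilde{\mathbf G}_s=[\tilde{\mathbf g}_{s1},\dots,\tilde{\mathbf g}_{sK_f}]\in\mathbb C^{M^\ast\times K_f}$. $[\mathbf A]_{(:,k)}$ denotes the $k$th column of $\mathbf A$. It is assumed that $\bar{\mathbf G}_s^H\bar{\mathbf G}_s$ is invertible and $\tilde{\mathbf G}_s^H\tilde{\mathbf G}_s$ is almost surely invertible for every $s$, and that the expectations below are finite. Visibility regions and powers. $\bar{\mathcal S}_i\subseteq\mathcal S$ ($i\in\mathcal{K_N}$) and $\tilde{\mathcal S}_j\subseteq\mathcal S$ ($j\in\mathcal{K_F}$) are given sets of subarrays serving each user (visibility regions); subarray $s$ serves a user if $s$ belongs to that user's visibility region. $P_n,P_f>0$ are powers, $\bar\eta_{si},\tilde\eta_{sj}\ge0$ are power-control coefficients, $\sigma_k^2>0$ is the noise power. Spectral efficiency of far-field user $k$ for given precoders $\bar{\mathbf w}_{si},\tilde{\mathbf w}_{sj}\in\mathbb C^{M^\ast}$: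 by definition $\widetilde{\mathrm{SE}}_k=\log_2(1+\widetilde{\mathrm{SINR}}_k)$, where $$\widetilde{\mathrm{SINR}}_k=\frac{|\widetilde{\mathrm{DS}}_k|^2}{\mathbb E\{|\widetilde{\mathrm{BU}}_k|^2\}+\sum_{j\in\mathcal{K_F}\setminus\{k\}}\mathbb E\{|\widetilde{\mathrm{UI}}^{\mathrm F}_j|^2\}+\sum_{i\in\mathcal{K_N}}\mathbb E\{|\widetilde{\mathrm{UI}}^{\mathrm N}_i|^2\}+\sigma_k^2},$$ with $X_k=\sum_{s\in\tilde{\mathcal S}_k}\sqrt{\tilde\eta_{sk}}\tilde{\mathbf g}_{sk}^H\tilde{\mathbf w}_{sk}$, $\widetilde{\mathrm{DS}}_k=\sqrt{P_f}\,\mathbb E\{X_k\}$, $\widetilde{\mathrm{BU}}_k=\sqrt{P_f}(X_k-\mathbb E\{X_k\})$, $\widetilde{\mathrm{UI}}^{\mathrm F}_j=\sqrt{P_f}\sum_{s\in\tilde{\mathcal S}_j}\sqrt{\tilde\eta_{sj}}\tilde{\mathbf g}_{sk}^H\tilde{\mathbf w}_{sj}$, $\widetilde{\mathrm{UI}}^{\mathrm N}_i=\sqrt{P_n}\sum_{s\in\bar{\mathcal S}_i}\sqrt{\bar\eta_{si}}\tilde{\mathbf g}_{sk}^H\bar{\mathbf w}_{si}$. Expectations are over $\tilde{\mathbf H}_2$; $\delta_{ss'}$ is the Kronecker delta.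
   Formalization: The formal theorem additionally assumes that every subarray serving far-field user k also serves at least one other user; where k is served alone by MRT, the channel gain is random, the beamforming-uncertainty term is positive, and the stated formula fails. *)

(* Defs.v *)
From HB Require Import structures.
From mathcomp Require Import all_boot all_order all_algebra.
From mathcomp Require Import all_classical all_reals all_analysis.
From mathcomp Require Import complex mxtens.

Set Implicit Arguments.
Unset Strict Implicit.
Unset Printing Implicit Defensive.

Import Order.TTheory GRing.Theory Num.Theory.
Import numFieldNormedType.Exports.

Local Open Scope classical_set_scope.
Local Open Scope ring_scope.
Local Open Scope complex_scope.
Local Open Scope sesquilinear_scope.

Definition cis (R : realType) (t : R) : R[i] := cos t +i* sin t.

Definition log2 (R : realType) (x : R) : R := ln x / ln 2.

Definition sqnormc (R : realType) (z : R[i]) : R := Normc.normc z ^+ 2.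

Section ComplexRandomVariables.
Context {R : realType} {d : measure_display} {T : measurableType d}.
Variable P : probability T R.

Definition reim (z : R[i]) : R * R := (complex.Re z, complex.Im z).

Definition mean (f : T -> R) : R := fine 'E_P[f].

Definition cmean (Z : T -> R[i]) : R[i] :=
  mean (fun w => complex.Re (Z w)) +i* mean (fun w => complex.Im (Z w)).

Definition rintegrable (f : T -> R) : Prop :=
  P.-integrable setT (fun w => (f w)%:E).

Definition cintegrable (Z : T -> R[i]) : Prop :=
  rintegrable (fun w => complex.Re (Z w)) /\
  rintegrable (fun w => complex.Im (Z w)).

(* Circular symmetry with E|Z|^2 = 1: the real and imaginary parts are
   independent centred Gaussians, each of variance 1/2.  The second argument of
   normal_prob is the standard deviation. *)
Definition std_complex_normal (Z : T -> R[i]) : Prop :=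
  let g := @normal_prob R 0 (Num.sqrt 2^-1) in
  measurable_fun setT (reim \o Z) /\
  forall A : set (R * R), measurable A ->
    P ((reim \o Z) @^-1` A) = (g \x g)%E A.

Definition mutually_independent (I : finType) (Z : I -> T -> R[i]) : Prop :=
  forall (J : {set I}) (A : I -> set (R * R)),
    (forall i, measurable (A i)) ->
    P (\bigcap_(i in [set i | i \in J]) ((reim \o Z i) @^-1` A i)) =
    (\prod_(i in J) fine (P ((reim \o Z i) @^-1` A i)))%:E.

Definition iid_std_complex_normal (m n : nat) (W : T -> 'M[R[i]]_(m, n)) :
    Prop :=
  (forall i j, std_complex_normal (fun w => W w i j)) /\
  mutually_independent (fun ij : 'I_m * 'I_n => fun w => W w ij.1 ij.2).

End ComplexRandomVariables.

(* Antennas, subarrays, users and RIS elements are numbered from 0. *)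
Record system (R : realType) := System {
  Mx : nat;
  My : nat;
  odd_Mx : odd Mx;
  odd_My : odd My;
  nsub : nat;
  nsub_dvd : (nsub %| Mx * My)%N;
  lambda : R;
  lambda_gt0 : 0 < lambda;
  Kn : nat;
  Kf : nat;
  N1 : nat;
  N2 : nat;
  N1_gt0 : (0 < N1)%N;
  N2_gt0 : (0 < N2)%N;
  theta : 'I_(N1 * N2) -> R;
  theta_range : forall n, 0 <= theta n < 2 * pi;
  ux : 'I_Kn -> R;
  uy : 'I_Kn -> R;
  uz : 'I_Kn -> R;
  uz_gt0 : forall i, 0 < uz i;
  iota2 : R;
  iota2_ge0 : 0 <= iota2;
  zeta2 : R;
  zeta2_gt0 : 0 < zeta2;
  phi_a : R; (* azimuth at the array *)
  phi_e : R; (* elevation at the array *)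
  varphi_a : R; (* azimuth at the RIS *)
  varphi_e : R; (* elevation at the RIS *)
  vartheta_a : 'I_Kf -> R;
  vartheta_e : 'I_Kf -> R;
  varsigma : 'I_Kf -> R;
  varsigma_gt0 : forall j, 0 < varsigma j;
  Snear : 'I_Kn -> {set 'I_nsub};
  Sfar : 'I_Kf -> {set 'I_nsub};
  Pn : R;
  Pn_gt0 : 0 < Pn;
  Pf : R;
  Pf_gt0 : 0 < Pf;
  eta_near : 'I_nsub -> 'I_Kn -> R;
  eta_near_ge0 : forall s i, 0 <= eta_near s i;
  eta_far : 'I_nsub -> 'I_Kf -> R;
  eta_far_ge0 : forall s j, 0 <= eta_far s j;
  sigma2 : 'I_Kf -> R;
  sigma2_gt0 : forall j, 0 < sigma2 j
}.

Section Channels.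
Context {R : realType}.
Variable p : system R.

Definition M : nat := (Mx p * My p)%N.
Definition Mstar : nat := (M %/ nsub p)%N.
Definition N : nat := (N1 p * N2 p)%N.

Lemma antenna_subproof (s : 'I_(nsub p)) (a : 'I_Mstar) :
  (s * Mstar + a < M)%N.
Proof.
rewrite -[ltnRHS](divnK (nsub_dvd p)) -/Mstar [ltnRHS]mulnC.
by rewrite (@leq_trans (s.+1 * Mstar)%N) ?leq_mul2r ?ltn_ord ?orbT//
  mulSn addnC ltn_add2r.
Qed.

Definition antenna (s : 'I_(nsub p)) (a : 'I_Mstar) : 'I_M :=
  Ordinal (antenna_subproof s a).

Definition spacing : R := lambda p / 2.

Definition antenna_x (m : 'I_M) : R :=
  (- ((Mx p)%:R - 1) / 2 + (m %% Mx p)%N%:R) * spacing.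
Definition antenna_y (m : 'I_M) : R :=
  (((My p)%:R - 1) / 2 - (m %/ Mx p)%N%:R) * spacing.

Definition dist (m : 'I_M) (i : 'I_(Kn p)) : R :=
  Num.sqrt ((ux i - antenna_x m) ^+ 2 + (uy i - antenna_y m) ^+ 2 + uz i ^+ 2).

Definition aperture : R := lambda p ^+ 2 / (4 * pi).

Definition near_coef (m : 'I_M) (i : 'I_(Kn p)) : R[i] :=
  (Num.sqrt (aperture / (4 * pi) *
     (uz i * ((ux i - antenna_x m) ^+ 2 + uz i ^+ 2) / dist m i ^+ 5)))%:C
  * cis (- (2 * pi * dist m i / lambda p)).

Definition near_channel (s : 'I_(nsub p)) (i : 'I_(Kn p)) : 'cV[R[i]]_Mstar :=
  \col_a near_coef (antenna s a) i.

Definition near_matrix (s : 'I_(nsub p)) : 'M[R[i]]_(Mstar, Kn p) :=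
  \matrix_(a, i) near_channel s i a 0.

Definition linear_steering (n : nat) (x : R) : 'cV[R[i]]_n :=
  \col_(m < n) cis (2 * pi * m%:R * x / lambda p).

(* The RIS element spacing is lambda / 2 as well. *)
Definition planar_steering (n1 n2 : nat) (az el : R) : 'cV[R[i]]_(n1 * n2) :=
  linear_steering n1 (spacing * cos el * sin az) *t
  linear_steering n2 (spacing * sin el).

Definition aM : 'cV[R[i]]_M :=
  planar_steering (Mx p) (My p) (phi_a p) (phi_e p).
Definition bN (az el : R) : 'cV[R[i]]_N := planar_steering (N1 p) (N2 p) az el.

Definition Theta : 'M[R[i]]_N := diag_mx (\row_n cis (theta n)).

Definition alpha2 : R := Num.sqrt (iota2 p * zeta2 p / (iota2 p + 1)).
Definition beta2 : R := Num.sqrt (zeta2 p / (iota2 p + 1)).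

Definition H2bar : 'M[R[i]]_(N, M) := bN (varphi_a p) (varphi_e p) *m aM ^t*.

Definition H2 (H2tilde : 'M[R[i]]_(N, M)) : 'M[R[i]]_(N, M) :=
  alpha2%:C *: H2bar + beta2%:C *: H2tilde.

Definition subarray_cols (A : 'M[R[i]]_(N, M)) (s : 'I_(nsub p)) :
  'M[R[i]]_(N, Mstar) := colsub (antenna s) A.

Definition ris_user (k : 'I_(Kf p)) : 'cV[R[i]]_N :=
  (Num.sqrt (varsigma k))%:C *: bN (vartheta_a k) (vartheta_e k).

Definition far_channel (H2tilde : 'M[R[i]]_(N, M)) (s : 'I_(nsub p))
    (k : 'I_(Kf p)) : 'cV[R[i]]_Mstar :=
  ((ris_user k) ^t* *m Theta *m subarray_cols (H2 H2tilde) s) ^t*.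

Definition far_matrix (H2tilde : 'M[R[i]]_(N, M)) (s : 'I_(nsub p)) :
    'M[R[i]]_(Mstar, Kf p) :=
  \matrix_(a, k) far_channel H2tilde s k a 0.

Definition users_served (s : 'I_(nsub p)) : nat :=
  (#|[set i | s \in Snear i]| + #|[set j | s \in Sfar j]|)%N.

(* At a subarray serving user k alone, lzf_far is the unnormalised MRT vector
   g, and g^H g is random, so the zero-forcing identity g^H w = 1 and with it
   the closed form of the SINR fail there.  Other users, near or far, may be
   served alone. *)
Definition not_alone (k : 'I_(Kf p)) : Prop :=
  forall s, s \in Sfar k -> (1 < users_served s)%N.

Definition zf (m n : nat) (G : 'M[R[i]]_(m, n)) : 'M[R[i]]_(m, n) :=
  G *m invmx (G ^t* *m G).

Definition lzf_near (s : 'I_(nsub p)) (i : 'I_(Kn p)) : 'cV[R[i]]_Mstar :=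
  if (users_served s == 1%N) && (s \in Snear i) then near_channel s i
  else col i (zf (near_matrix s)).

Definition lzf_far (H2tilde : 'M[R[i]]_(N, M)) (s : 'I_(nsub p))
    (j : 'I_(Kf p)) : 'cV[R[i]]_Mstar :=
  if (users_served s == 1%N) && (s \in Sfar j) then far_channel H2tilde s j
  else col j (zf (far_matrix H2tilde s)).

Definition Mkk (k : 'I_(Kf p)) : 'M[R[i]]_N :=
  Theta ^t* *m ris_user k *m (ris_user k) ^t* *m Theta.

Definition Bmx (k : 'I_(Kf p)) (s s' : 'I_(nsub p)) : 'M[R[i]]_Mstar :=
  (alpha2 ^+ 2)%:C *:
    ((subarray_cols H2bar s') ^t* *m Mkk k *m subarray_cols H2bar s)
  + ((s == s')%:R * varsigma k * beta2 ^+ 2 * N%:R)%:C%:M.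

Definition tau_near (k : 'I_(Kf p)) (i : 'I_(Kn p)) (s s' : 'I_(nsub p)) : R :=
  complex.Re (((lzf_near s' i) ^t* *m Bmx k s s' *m lzf_near s i) 0 0).

End Channels.

Section SpectralEfficiency.
Context {R : realType} {d : measure_display} {T : measurableType d}.
Variables (P : probability T R) (p : system R).
Variable H2tilde : T -> 'M[R[i]]_(N p, M p).
Variable wnear : 'I_(nsub p) -> 'I_(Kn p) -> 'cV[R[i]]_(Mstar p).
Variable wfar : T -> 'I_(nsub p) -> 'I_(Kf p) -> 'cV[R[i]]_(Mstar p).
Variable k : 'I_(Kf p).

Definition gain (w : T) (s : 'I_(nsub p)) (v : 'cV[R[i]]_(Mstar p)) : R[i] :=
  ((far_channel (H2tilde w) s k) ^t* *m v) 0 0.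

(* [far_signal k] is X_k; for j <> k, [far_signal j] is UI^F_j without the
   factor sqrt Pf. *)
Definition far_signal (j : 'I_(Kf p)) (w : T) : R[i] :=
  \sum_(s in Sfar j) (Num.sqrt (eta_far s j))%:C * gain w s (wfar w s j).

Definition DS : R[i] := (Num.sqrt (Pf p))%:C * cmean P (far_signal k).

Definition BU (w : T) : R[i] :=
  (Num.sqrt (Pf p))%:C * (far_signal k w - cmean P (far_signal k)).

Definition UIF (j : 'I_(Kf p)) (w : T) : R[i] :=
  (Num.sqrt (Pf p))%:C * far_signal j w.

Definition UIN (i : 'I_(Kn p)) (w : T) : R[i] :=
  (Num.sqrt (Pn p))%:C *
  \sum_(s in Snear i) (Num.sqrt (eta_near s i))%:C * gain w s (wnear s i).

Definition finite_expectations : Prop :=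
  [/\ cintegrable P (far_signal k),
      rintegrable P (fun w => sqnormc (BU w)),
      forall j, j != k -> rintegrable P (fun w => sqnormc (UIF j w)) &
      forall i, rintegrable P (fun w => sqnormc (UIN i w))].

Definition SINR : R :=
  sqnormc DS /
  (mean P (fun w => sqnormc (BU w))
   + \sum_(j | j != k) mean P (fun w => sqnormc (UIF j w))
   + \sum_i mean P (fun w => sqnormc (UIN i w))
   + sigma2 k).

Definition SE : R := log2 (1 + SINR).

End SpectralEfficiency.

(* Main.v *)
(* At a subarray serving user k and somebody else, zero forcing gives
   g_sk^H w_sk = 1 almost surely, so X_k is almost surely the constant
   sum_s sqrt(eta_sk): this is the numerator, and the beamforming uncertainty
   vanishes.  The near-field precoders are deterministic, so the interference
   of near-field user i is D + sum_a c_a W_a with D and c deterministic and W_a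
   entries of H2tilde.  Their real and imaginary parts are centred, of variance
   1/2 and pairwise uncorrelated, whence E|D + sum_a c_a W_a|^2 =
   |D|^2 + sum_a |c_a|^2.  The term |D|^2 is the quadratic form of M_kk, and
   sum_a |c_a|^2 produces the identity part of B_ki^ss' because the entries of
   h_k^H Theta have squared modulus varsigma_k. *)
Require Import Defs.
From HB Require Import structures.
From mathcomp Require Import all_boot all_order all_algebra.
From mathcomp Require Import all_classical all_reals all_analysis.
From mathcomp Require Import complex mxtens.
From mathcomp Require Import measurable_realfun ring lra.

Set Implicit Arguments.
Unset Strict Implicit.
Unset Printing Implicit Defensive.

Import Order.TTheory GRing.Theory Num.Theory.
Import numFieldNormedType.Exports.

Local Open Scope classical_set_scope.
Local Open Scope ring_scope.
Local Open Scope complex_scope.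
Local Open Scope sesquilinear_scope.

(** * Moments of the centred Gaussian of variance 1/2 *)

Section GaussianMoments.
Context {R : realType}.
Local Notation mu := (@lebesgue_measure R).

(** The Radon-Nikodym derivative of [normal_prob] and [normal_pdf] have the same integral over every
    measurable set, so they agree almost everywhere. *)
Lemma ge0_integral_normal_prob (m s : R) (f : R -> R) :
  (forall x, 0 <= f x) -> measurable_fun setT f ->
  (\int[normal_prob m s]_x (f x)%:E =
   \int[mu]_x (f x * normal_pdf m s x)%:E)%E.
Proof.
move=> f0 mf.
have dom := normal_prob_dominates m s.
have mpdf : measurable_fun [set: R] (EFin \o normal_pdf m s).
  by apply/measurable_EFinP; exact: measurable_normal_pdf.
have iRN := Radon_Nikodym_SigmaFinite.f_integrable dom.
rewrite -(Radon_Nikodym_SigmaFinite.change_of_variables dom)//; last first.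
- exact/measurable_EFinP.
under [RHS]eq_integral do rewrite EFinM.
apply: ae_eq_integral => //.
- apply: emeasurable_funM; first exact/measurable_EFinP.
  exact: (measurable_int mu).
- by apply: emeasurable_funM => //; exact/measurable_EFinP.
- apply: ae_eqe_mul2l; apply: integral_ae_eq => // E _ mE.
  by rewrite -(Radon_Nikodym_SigmaFinite.f_integral dom).
Qed.

(** Squeezed between 0 and [x^-1], since [expR (x ^+ 2)] is at least [1 + x ^+ 2]. This is the
    boundary term at infinity of the integration by parts. *)
Lemma cvg_mulr_gauss_fun : x * gauss_fun x @[x --> +oo] --> (0 : R).
Proof.
apply: (@squeeze_cvgr _ _ _ _ (cst 0) (fun x => x^-1)).
- near=> x.
  have x0 : 0 < x by near: x; exact: nbhs_pinfty_gt.
  rewrite /= mulr_ge0 ?(ltW x0) ?gauss_fun_ge0//=.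
  rewrite /gauss_fun expRN -ler_pdivlMl// -invfM.
  rewrite ler_pV2 ?inE ?unitfE; last 2 first.
  - by rewrite expR_gt0 gt_eqF ?expR_gt0.
  - by rewrite mulf_neq0 ?gt_eqF//= mulr_gt0.
  by rewrite -expr2 (le_trans _ (expR_ge1Dx _))// lerDr.
- exact: cvg_cst.
- by apply/gtr0_cvgV0 => //; exact: nbhs_pinfty_gt.
Unshelve. all: by end_near. Qed.

(** The limit [pi / 4] of the square is known; nonnegativity of the integral allows taking the
    square root. *)
Lemma cvg_integral0_gauss :
  gauss_integral_proof.integral0_gauss x @[x --> +oo] --> (Num.sqrt pi / 2 : R).
Proof.
rewrite (_ : Num.sqrt pi / 2 = Num.sqrt (pi / 4)); last first.
  rewrite sqrtrM ?pi_ge0// sqrtrV// (_ : 4 = 2 ^+ 2) ?sqrtr_sqr ?ger0_norm//.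
  by rewrite expr2 -natrM.
rewrite (_ : gauss_integral_proof.integral0_gauss =
  fun x => Num.sqrt (gauss_integral_proof.integral0_gauss x ^+ 2)); last first.
  apply/funext => r; rewrite sqrtr_sqr ger0_norm//.
  exact: gauss_integral_proof.integral0_gauss_ge0.
apply: continuous_cvg; first exact: sqrt_continuous.
exact: gauss_integral_proof.cvg_integral0_gauss_sqr.
Qed.

(* Its derivative x^2 e^{-x^2} is nonnegative, as the improper fundamental
   theorem of calculus requires; the antiderivative -x e^{-x^2} / 2 left by
   integration by parts has a derivative that changes sign. *)
Let primitive (x : R) : R :=
  2^-1 * (gauss_integral_proof.integral0_gauss x - x * gauss_fun x).

(** The derivative of [x * gauss_fun x] is [gauss_fun x - 2 * x ^+ 2 * gauss_fun x]; its first term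
    cancels the derivative of the integral. *)
Let derive_primitive (x : R) : 0 < x ->
  is_derive x 1 primitive (x ^+ 2 * gauss_fun x).
Proof.
move=> x0.
have [dI DI] : derivable (gauss_integral_proof.integral0_gauss (R := R)) x 1 /\
    derive1 (gauss_integral_proof.integral0_gauss (R := R)) x = gauss_fun x.
  apply: (@continuous_FTC1 R gauss_fun (BLeft 0) _ (x + 1) _ _ _ _).
  - by rewrite ltrDl.
  - apply: continuous_compact_integrable; first exact: segment_compact.
    by apply: continuous_subspaceT; exact: continuous_gauss_fun.
  - by rewrite lte_fin.
  - exact: continuous_gauss_fun.
have HI : is_derive x 1 (gauss_integral_proof.integral0_gauss (R := R))
    (gauss_fun x).
  by apply: DeriveDef => //; rewrite -derive1E.
have HG : is_derive x 1 (gauss_fun (R := R)) (- (2 * x) * gauss_fun x).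
  rewrite /gauss_fun; apply: is_derive_eq.
  by rewrite /GRing.scale /=; ring.
rewrite /primitive; apply: is_derive_eq.
by rewrite /GRing.scale /=; lra.
Qed.

Lemma integral0y_sqr_gauss :
  (\int[mu]_(x in `[0%R, +oo[) (x ^+ 2 * gauss_fun x)%:E =
   (Num.sqrt pi / 4)%:E)%E.
Proof.
rewrite (@ge0_continuous_FTC2y _ _ primitive _ (Num.sqrt pi / 4)).
- rewrite /primitive /gauss_integral_proof.integral0_gauss set_itv1.
  by rewrite Rintegral_set1 mul0r subr0 mulr0 sube0.
- by move=> x _; rewrite mulr_ge0 ?sqr_ge0 ?gauss_fun_ge0.
- apply: continuous_subspaceT => x.
  apply: cvgM; last exact: continuous_gauss_fun.
  exact: exprn_continuous.
- rewrite (_ : _ / 4 = 2^-1 * (Num.sqrt pi / 2 - 0)); last by field.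
  apply: cvgMr; apply: cvgB; first exact: cvg_integral0_gauss.
  exact: cvg_mulr_gauss_fun.
- by move=> x x0; have [] := derive_primitive x0.
(* Continuity at 0: both terms of [primitive] vanish there, the integral being over a single
   point. *)
- apply: cvg_at_right_filter; rewrite /primitive.
  rewrite (_ : 2^-1 * _ = 2^-1 * (0 - 0 * gauss_fun 0)); last first.
    by rewrite /gauss_integral_proof.integral0_gauss set_itv1 Rintegral_set1.
  apply: cvgMr; apply: cvgB; last first.
    by apply: cvgM; [exact: cvg_id|exact: continuous_gauss_fun].
  apply: (@parameterized_integral_cvg_left _ 0 1 gauss_fun ltr01).
  apply: continuous_compact_integrable; first exact: segment_compact.
  by apply: continuous_subspaceT; exact: continuous_gauss_fun.
- move=> x; rewrite in_itv/= andbT => x0; rewrite derive1E.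
  by have [] := derive_primitive x0.
Qed.

Lemma integral_sqr_gauss :
  (\int[mu]_x (x ^+ 2 * gauss_fun x)%:E = (Num.sqrt pi / 2)%:E)%E.
Proof.
rewrite ge0_symfun_integralT//=.
- rewrite (_ : [set x | _] = `[0, +oo[%classic); last first.
    by apply/seteqP; split => x/=; rewrite in_itv/= andbT.
  by rewrite integral0y_sqr_gauss -EFinM; congr EFin; field.
- by move=> x; rewrite mulr_ge0 ?sqr_ge0 ?gauss_fun_ge0.
- move=> x.
  by apply: cvgM; [exact: exprn_continuous|exact: continuous_gauss_fun].
- by move=> x/=; rewrite /gauss_fun sqrrN.
Qed.

Local Notation half_normal := (normal_prob (0 : R) (Num.sqrt 2^-1)).

(** At variance 1/2 the exponent [- x ^+ 2 / (2 * s ^+ 2)] is [- x ^+ 2], which brings the moments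
    back to [gauss_fun]. *)
Lemma normal_pdf_half (x : R) :
  normal_pdf 0 (Num.sqrt 2^-1) x = gauss_fun x / Num.sqrt pi.
Proof.
rewrite normal_pdfE ?sqrtr_eq0 -?ltNge// /normal_peak /normal_fun.
rewrite sqr_sqrtr// subr0 -(mulr_natr 2^-1) mulVf// divr1 mulrC.
by rewrite -mulr_natr mulrAC mulVf// mul1r.
Qed.

Lemma integral_half_normal_sqr :
  (\int[half_normal]_x (x ^+ 2)%:E = (2^-1)%:E)%E.
Proof.
rewrite ge0_integral_normal_prob; last 2 first.
- by move=> x; exact: sqr_ge0.
- exact: measurable_funX.
under eq_integral do rewrite normal_pdf_half mulrA mulrC EFinM.
rewrite ge0_integralZl//=; last 2 first.
- apply/measurable_EFinP/measurable_funM; first exact: measurable_funX.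
  exact: measurable_gauss_fun.
- by move=> x _; rewrite lee_fin mulr_ge0 ?sqr_ge0 ?gauss_fun_ge0.
rewrite integral_sqr_gauss -EFinM mulrA mulVf ?mul1r//.
by rewrite gt_eqF// sqrtr_gt0 pi_gt0.
Qed.

Lemma integrable_half_normal_sqr :
  half_normal.-integrable setT (fun x => (x ^+ 2)%:E).
Proof.
apply/integrableP; split; first exact/measurable_EFinP/measurable_funX.
under eq_integral do rewrite gee0_abs ?lee_fin ?sqr_ge0//.
by rewrite integral_half_normal_sqr ltry.
Qed.

(** Dominated by [1 + x ^+ 2], as the square of [|x| - 1] is nonnegative. *)
Lemma integrable_half_normal : half_normal.-integrable setT (fun x => x%:E).
Proof.
have i1 : half_normal.-integrable setT (fun x => 1 + (x ^+ 2)%:E)%E.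
  apply: integrableD => //; last exact: integrable_half_normal_sqr.
  exact: finite_measure_integrable_cst.
apply: le_integrable i1 => //; first exact/measurable_EFinP.
move=> x _; rewrite -EFinD !abse_EFin lee_fin.
rewrite [leRHS]ger0_norm ?addr_ge0 ?sqr_ge0// -real_normK ?num_real//.
have := sqr_ge0 (`|x| - 1); have := sqr_ge0 `|x|; nra.
Qed.

(** Lebesgue measure is invariant under reflection and the centred density is even. *)
Lemma normal_prob0N (s : R) (A : set R) : s != 0 -> measurable A ->
  pushforward (normal_prob 0 s) (-%R : R -> measurableTypeR R) A =
  normal_prob 0 s A.
Proof.
move=> s0 mA; rewrite /pushforward /normal_prob.
transitivity
    (\int[pushforward mu (-%R : _ -> measurableTypeR R)]_(x in A)
       (normal_pdf 0 s x)%:E)%E; last first.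
  by apply: eq_measure_integral => B mB _; exact: lebesgue_measureN.
rewrite ge0_integral_pushforward//=.
- apply: eq_integral => x _.
  by rewrite !normal_pdfE// /normal_fun !subr0 sqrrN.
- by apply/measurable_EFinP/measurable_funTS; exact: measurable_normal_pdf.
- by move=> x _; rewrite lee_fin normal_pdf_ge0.
Qed.

(** By symmetry the integral equals its opposite; being finite, it is 0. *)
Lemma integral_half_normal : (\int[half_normal]_x x%:E = 0)%E.
Proof.
have i1 := integrable_half_normal.
have s0 : Num.sqrt 2^-1 != 0 :> R by rewrite sqrtr_eq0 -ltNge.
suff : (\int[half_normal]_x x%:E = - \int[half_normal]_x x%:E)%E.
  have := integrable_fin_num measurableT i1.
  by case: integral => // r _ [] rN; congr EFin; lra.
rewrite -integralN/=; last exact: integrable_add_def.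
transitivity (\int[pushforward half_normal (-%R : R -> measurableTypeR R)]_x
    x%:E)%E.
  by apply: eq_measure_integral => B mB _; exact/esym/normal_prob0N.
rewrite integral_pushforward//.
exact: (integrableN i1).
Qed.

End GaussianMoments.

(** * Integrals of functions of a random element through its law *)

Section Law.
Context {R : realType} {d d' : measure_display} {T : measurableType d}
  {U : measurableType d'}.
Variables (P : {measure set T -> \bar R}) (Q : {measure set U -> \bar R}).
Variables (X : T -> U) (mX : measurable_fun setT X).
Hypothesis lawX : forall A, measurable A -> P (X @^-1` A) = Q A.

(** By [lawX] the pushforward of [P] along [X] coincides with [Q] on measurable sets. This and the
    next two lemmas carry Gaussian moments over to random variables. *)
Lemma ge0_integral_law (f : U -> \bar R) :
  measurable_fun setT f -> (forall u, 0 <= f u)%E ->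
  (\int[P]_w f (X w) = \int[Q]_u f u)%E.
Proof.
move=> mf f0; have := ge0_integral_pushforward mX P measurableT mf (in1W f0).
rewrite preimage_setT => <-.
by apply: eq_measure_integral => A mA _; exact: lawX.
Qed.

Lemma integrable_law (f : U -> \bar R) :
  Q.-integrable setT f -> P.-integrable setT (f \o X).
Proof.
move=> /integrableP[mf foo]; apply/integrableP; split.
  exact: measurableT_comp.
rewrite (ge0_integral_law (f := fun u => `|f u|%E))//.
exact: measurableT_comp.
Qed.

Lemma integral_law (f : U -> \bar R) : Q.-integrable setT f ->
  (\int[P]_w f (X w) = \int[Q]_u f u)%E.
Proof.
move=> fi; have [mf _] := integrableP _ _ _ fi.
have := @integral_pushforward _ _ _ _ _ _ mX P setT f mf.
rewrite preimage_setT => <- //; last exact: integrable_law.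
by apply: eq_measure_integral => A mA _; exact: lawX.
Qed.

End Law.

(** * The product of two independent Gaussian coordinates *)

Section HalfNormalProduct.
Context {R : realType}.
Local Notation g := (normal_prob (0 : R) (Num.sqrt 2^-1)).

(** By Tonelli the integral of the absolute value is the product of two finite first absolute
    moments. *)
Lemma integrable_half_normal_prod :
  (g \x g)%E.-integrable setT (fun z => (z.1 * z.2)%:E).
Proof.
apply/integrable12ltyP.
  by apply/measurable_EFinP; exact: measurable_funM.
have [_ goo] := integrableP _ _ _ (@integrable_half_normal R).
have gf : (\int[g]_x `|x%:E| \is a fin_num)%E.
  by rewrite ge0_fin_numE//; exact: integral_ge0.
have E (x : R) : (\int[g]_y `|(x * y)%:E| = `|x%:E| * \int[g]_y `|y%:E|)%E.
  under eq_integral do rewrite EFinM abseM.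
  rewrite ge0_integralZl//=.
  by apply/measurable_EFinP; exact: normr_measurable.
under eq_integral do rewrite E.
rewrite ge0_integralZr ?integral_ge0//=; last first.
  by apply/measurable_EFinP; exact: normr_measurable.
by rewrite lte_mul_pinfty// ?integral_ge0.
Qed.

Lemma integral_half_normal_prod : (\int[g \x g]_z (z.1 * z.2)%:E = 0)%E.
Proof.
rewrite -(integral12_prod_meas1 integrable_half_normal_prod)/fubini_F/=.
apply: integral0_eq => x _; under eq_integral do rewrite EFinM.
rewrite integralZl//; last exact: integrable_half_normal.
by rewrite integral_half_normal mule0.
Qed.

End HalfNormalProduct.

(** * Real expectations, and second moments of affine combinations *)

Section Mean.
Context {R : realType} {d : measure_display} {T : measurableType d}.
Variable P : probability T R.
Implicit Types f g : T -> R.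

Lemma meanE f : mean P f = fine (\int[P]_w (f w)%:E)%E.
Proof. by rewrite /mean unlock. Qed.

Lemma rintegrable_cst (c : R) : rintegrable P (fun=> c).
Proof. exact: finite_measure_integrable_cst. Qed.

Lemma mean_cst (c : R) : mean P (fun=> c) = c.
Proof. by rewrite /mean expectation_cst. Qed.

Lemma rintegrableD f g : rintegrable P f -> rintegrable P g ->
  rintegrable P (fun w => f w + g w).
Proof. exact: integrableD. Qed.

Lemma meanD f g : rintegrable P f -> rintegrable P g ->
  mean P (fun w => f w + g w) = mean P f + mean P g.
Proof.
move=> fi gi; rewrite !meanE -fineD ?integrable_fin_num//.
by rewrite -integralD_EFin.
Qed.

Lemma rintegrableZl c f : rintegrable P f -> rintegrable P (fun w => c * f w).
Proof. exact: integrableZl. Qed.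

(** [finite_expectations] bounds the interference terms with their power factor; this removes the
    factor so that [meanZl] applies. *)
Lemma rintegrableZl_inv c f : c != 0 ->
  rintegrable P (fun w => c * f w) -> rintegrable P f.
Proof.
move=> c0 /(rintegrableZl c^-1).
by under [X in rintegrable _ X -> _]eq_fun do rewrite mulKf//.
Qed.

Lemma meanZl c f : rintegrable P f ->
  mean P (fun w => c * f w) = c * mean P f.
Proof.
move=> fi; rewrite !meanE.
under eq_integral do rewrite EFinM.
by rewrite integralZl// fineM// integrable_fin_num.
Qed.

Lemma rintegrable_sum (I : Type) (s : seq I) (f : I -> T -> R) :
  (forall i, rintegrable P (f i)) ->
  rintegrable P (fun w => \sum_(i <- s) f i w).
Proof.
move=> fi; elim: s => [|i s IHs].
  under [X in rintegrable _ X]eq_fun do rewrite big_nil.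
  exact: rintegrable_cst.
under [X in rintegrable _ X]eq_fun do rewrite big_cons.
exact: rintegrableD.
Qed.

Lemma mean_sum (I : Type) (s : seq I) (f : I -> T -> R) :
  (forall i, rintegrable P (f i)) ->
  mean P (fun w => \sum_(i <- s) f i w) = \sum_(i <- s) mean P (f i).
Proof.
move=> fi; elim: s => [|i s IHs].
  by under [X in mean _ X]eq_fun do rewrite big_nil; rewrite big_nil mean_cst.
under [X in mean _ X]eq_fun do rewrite big_cons.
rewrite big_cons meanD ?IHs//; exact: rintegrable_sum.
Qed.

Lemma ae_eq_mean f g : rintegrable P f -> measurable_fun setT g ->
  {ae P, forall w, f w = g w} -> mean P f = mean P g.
Proof.
move=> /integrableP[mf _] mg fg; rewrite !meanE; congr fine.
apply: ae_eq_integral => //; first exact/measurable_EFinP.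
by apply: filterS fg => w /= -> .
Qed.

Section Orthogonal.
Context {I : finType} (f : I -> T -> R) (v : R).
Hypothesis fi : forall i, rintegrable P (f i).
Hypothesis f0 : forall i, mean P (f i) = 0.
Hypothesis ffi : forall i j, rintegrable P (fun w => f i w * f j w).
Hypothesis ff : forall i j, mean P (fun w => f i w * f j w) = (i == j)%:R * v.

Let sqr_affine (a : R) (c : I -> R) w : (a + \sum_i c i * f i w) ^+ 2 =
  a ^+ 2 + \sum_i (2 * a * c i) * f i w +
  \sum_i \sum_j c i * c j * (f i w * f j w).
Proof.
rewrite sqrrD; congr (_ + _ + _).
  rewrite -mulr_natl mulrA mulr_sumr; apply: eq_bigr => i _; exact: mulrA.
rewrite expr2 mulr_suml; apply: eq_bigr => i _.
rewrite mulr_sumr; apply: eq_bigr => j _; ring.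
Qed.

Lemma rintegrable_sqr_affine (a : R) (c : I -> R) :
  rintegrable P (fun w => (a + \sum_i c i * f i w) ^+ 2).
Proof.
under [X in rintegrable _ X]eq_fun do rewrite sqr_affine.
apply: rintegrableD; first apply: rintegrableD.
- exact: rintegrable_cst.
- by apply: rintegrable_sum => i; exact: rintegrableZl.
- apply: rintegrable_sum => i; apply: rintegrable_sum => j.
  exact: rintegrableZl.
Qed.

(** Once the square is expanded, the linear part has mean 0 by [f0], and [ff] leaves only the
    diagonal of the double sum. *)
Lemma mean_sqr_affine (a : R) (c : I -> R) :
  mean P (fun w => (a + \sum_i c i * f i w) ^+ 2) =
  a ^+ 2 + v * \sum_i c i ^+ 2.
Proof.
have i1 : rintegrable P (fun w => \sum_i (2 * a * c i) * f i w).
  by apply: rintegrable_sum => i; exact: rintegrableZl.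
have i2 i : rintegrable P (fun w => \sum_j c i * c j * (f i w * f j w)).
  by apply: rintegrable_sum => j; exact: rintegrableZl.
under [X in mean _ X]eq_fun do rewrite sqr_affine.
rewrite meanD; last 2 first.
- by apply: rintegrableD => //; exact: rintegrable_cst.
- exact: rintegrable_sum.
rewrite meanD//; last exact: rintegrable_cst.
rewrite mean_cst mean_sum; last by move=> i; exact: rintegrableZl.
rewrite big1 ?addr0; last by move=> i _; rewrite meanZl// f0 mulr0.
congr (_ + _); rewrite mean_sum// mulr_sumr; apply: eq_bigr => i _.
rewrite mean_sum; last by move=> j; exact: rintegrableZl.
rewrite (bigD1 i)//= meanZl// ff eqxx mul1r big1 ?addr0.
  by rewrite expr2 mulrC.
by move=> j ji; rewrite meanZl// ff eq_sym (negbTE ji) mul0r mulr0.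
Qed.

End Orthogonal.

End Mean.

(** * Algebra of the squared modulus *)

Section ComplexModulus.
Context {R : realType}.
Implicit Types x y z : R[i].

Lemma complex_ReM x y :
  complex.Re (x * y) =
  complex.Re x * complex.Re y - complex.Im x * complex.Im y.
Proof. by case: x y => [? ?] [? ?]. Qed.

Lemma complex_ImM x y :
  complex.Im (x * y) =
  complex.Re x * complex.Im y + complex.Im x * complex.Re y.
Proof. by case: x y => [? ?] [? ?]. Qed.

Lemma sqnormcE z : sqnormc z = complex.Re z ^+ 2 + complex.Im z ^+ 2.
Proof.
by case: z => x y; rewrite /sqnormc /= sqr_sqrtr// addr_ge0 ?sqr_ge0.
Qed.

Lemma sqnormcM x y : sqnormc (x * y) = sqnormc x * sqnormc y.
Proof. rewrite !sqnormcE complex_ReM complex_ImM; ring. Qed.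

Lemma sqnormc_conj z : sqnormc z^*%R = sqnormc z.
Proof. by case: z => a b; rewrite !sqnormcE /= sqrrN. Qed.

Lemma sqnormc_real (r : R) : sqnormc r%:C = r ^+ 2.
Proof. by rewrite sqnormcE /= expr0n addr0. Qed.

Lemma sqnormc_cis (t : R) : sqnormc (cis t) = 1.
Proof. by rewrite sqnormcE /= cos2Dsin2. Qed.

Lemma Re_conjM z : complex.Re (z^*%R * z) = sqnormc z.
Proof. by case: z => a b; rewrite sqnormcE /=; ring. Qed.

(** Expands the product of the sum with its conjugate; the result has the shape of the double sum
    over subarrays of [tau_near]. *)
Lemma sqnormc_sum_in (I : finType) (S : {set I}) (F : I -> R[i]) :
  sqnormc (\sum_(i in S) F i) =
  \sum_(i in S) \sum_(j in S) complex.Re ((F j)^*%R * F i).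
Proof.
rewrite -Re_conjM rmorph_sum mulr_sumr raddf_sum; apply: eq_bigr => i _.
by rewrite mulr_suml raddf_sum.
Qed.

Lemma conj_realM (r : R) z : (r%:C * z)^*%R = r%:C * z^*%R.
Proof. by rewrite rmorphM; congr (_ * _); exact: conjc_real. Qed.

Lemma mulmxtC11 (A B : 'M[R[i]]_1) :
  (A ^t* *m B) 0 0 = (A 0 0)^*%R * B 0 0.
Proof. by rewrite mxE big_ord1 !mxE. Qed.

Lemma complex_ReZ (r : R) z : complex.Re (r%:C * z) = r * complex.Re z.
Proof. by rewrite complex_ReM /= mul0r subr0. Qed.

Lemma sqnormc_sqrtM (r : R) z : 0 <= r ->
  sqnormc ((Num.sqrt r)%:C * z) = r * sqnormc z.
Proof. by move=> r0; rewrite sqnormcM sqnormc_real sqr_sqrtr. Qed.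

Lemma trmxC_mul (m n q : nat) (A : 'M[R[i]]_(m, n)) (B : 'M[R[i]]_(n, q)) :
  (A *m B) ^t* = B ^t* *m A ^t*.
Proof. by rewrite trmx_mul map_mxM. Qed.

End ComplexModulus.

(** * Orthogonality of the real and imaginary parts of the Gaussian entries *)

Section ComplexNormalEntries.
Context {R : realType} {d : measure_display} {T : measurableType d}.
Variables (P : probability T R) (m n : nat) (W : T -> 'M[R[i]]_(m, n)).
Hypothesis Wiid : iid_std_complex_normal P W.
Local Notation g := (normal_prob (0 : R) (Num.sqrt 2^-1)).
Local Notation idx := ('I_m * 'I_n * bool)%type.

(** Events on one part become events on the pair [reim], the form in which [std_complex_normal] and
    [mutually_independent] are stated. *)
Let cyl (b : bool) (A : set R) : set (R * R) :=
  if b then setT `*` A else A `*` setT.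

(** All real coordinates of the matrix form one family, to which [mean_sqr_affine] applies. *)
Definition entry_part (a : idx) (w : T) : R :=
  if a.2 then complex.Im (W w a.1.1 a.1.2) else complex.Re (W w a.1.1 a.1.2).

Let preimage_entry_part a A : entry_part a @^-1` A =
  (reim \o (fun w => W w a.1.1 a.1.2)) @^-1` cyl a.2 A.
Proof.
rewrite /entry_part /cyl; case: a => -[i j] [] /=; apply/seteqP; split=> w //=.
- by move=> [].
- by move=> [].
Qed.

Let cylI A B : cyl true A `&` cyl false B = B `*` A.
Proof.
by apply/seteqP; split=> [[x y] /= [[_ ?] [? _]]|[x y] /= [? ?]].
Qed.

Let measurable_cyl b A : measurable A -> measurable (cyl b A).
Proof. by move=> mA; rewrite /cyl; case: b; exact: measurableX. Qed.

Lemma measurable_entry_part a :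
  measurable_fun setT (entry_part a : T -> measurableTypeR R).
Proof.
have [+ _] := Wiid.1 a.1.1 a.1.2; rewrite /entry_part.
case: a => -[i j] [] /= mW.
- exact: (measurableT_comp measurable_snd mW).
- exact: (measurableT_comp measurable_fst mW).
Qed.

Let prod_setTl A : measurable A -> ((g \x g) (setT `*` A) = g A)%E.
Proof.
move=> mA; rewrite product_measure1E//.
by rewrite [X in (X * _)%E]probability_setT mul1e.
Qed.

Let prod_setTr A : measurable A -> ((g \x g) (A `*` setT) = g A)%E.
Proof.
move=> mA; rewrite product_measure1E//.
by rewrite [X in (_ * X)%E]probability_setT mule1.
Qed.

Lemma entry_part_law a (A : set (measurableTypeR R)) : measurable A ->
  P (entry_part a @^-1` A) = g A.
Proof.
move=> mA; rewrite preimage_entry_part.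
have [_ ->] := Wiid.1 a.1.1 a.1.2; last exact: measurable_cyl.
by rewrite /cyl; case: a.2; rewrite ?prod_setTl ?prod_setTr.
Qed.

(** A product measure is determined by its values on rectangles. On these, the two parts of one
    entry are independent by [std_complex_normal], parts of distinct entries by
    [mutually_independent]. *)
Lemma entry_part_pair_law a b
    (A : set (measurableTypeR R * measurableTypeR R)) :
  a != b -> measurable A ->
  P ((fun w => (entry_part a w, entry_part b w)) @^-1` A) = (g \x g)%E A.
Proof.
move=> ab mA.
have mab : measurable_fun setT
    (fun w => (entry_part a w, entry_part b w)
              : measurableTypeR R * measurableTypeR R).
  by apply: measurable_fun_pair; exact: measurable_entry_part.
pose phi : {mfun T >-> (measurableTypeR R * measurableTypeR R)%type} :=
  MeasurableFun.Pack
    (MeasurableFun.Class (isMeasurableFun.Build _ _ _ _ _ mab)).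
rewrite (@product_measure_unique _ _ _ _ _ g g (distribution P phi))//.
move=> {mA} {}A B mA mB; rewrite /distribution /pushforward/=.
transitivity (P (entry_part a @^-1` A `&` entry_part b @^-1` B)).
  by congr (P _); apply/seteqP; split=> w /=.
rewrite !preimage_entry_part.
have [ab1|ab1] := eqVneq a.1 b.1.
  have [_ lawW] := Wiid.1 a.1.1 a.1.2.
  have {ab} : a.2 != b.2.
    apply: contraNneq ab => ab2.
    by rewrite [a]surjective_pairing ab1 ab2 -surjective_pairing.
  rewrite -ab1 -preimage_setI lawW; last first.
    by apply: measurableI; exact: measurable_cyl.
  case: a.2 b.2 => [] [] //= _.
  (* Here [a] is the imaginary part, the second coordinate, so the rectangle comes out with its
     sides exchanged. *)
  - by rewrite cylI product_measure1E; [exact: muleC|exact: mB|exact: mA].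
  - by rewrite setIC cylI product_measure1E; [|exact: mA|exact: mB].
(* Independence takes a family over all entries; only its values at [a.1] and [b.1] enter the
   intersection. *)
pose C (i : 'I_m * 'I_n) := if i == a.1 then cyl a.2 A else cyl b.2 B.
have mC i : measurable (C i).
  by rewrite /C; case: ifP => _; exact: measurable_cyl.
have := Wiid.2 [set a.1; b.1]%SET C mC.
have aC : C a.1 = cyl a.2 A by rewrite /C eqxx.
have bC : C b.1 = cyl b.2 B by rewrite /C eq_sym (negbTE ab1).
rewrite (_ : \bigcap_(i in _) _ =
  (reim \o (fun w => W w a.1.1 a.1.2)) @^-1` C a.1 `&`
  (reim \o (fun w => W w b.1.1 b.1.2)) @^-1` C b.1); last first.
  apply/seteqP; split=> w /=.
    by move=> Cw; split; apply: Cw; rewrite /= !inE eqxx ?orbT.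
  by move=> [Ca Cb] i /=; rewrite !inE => /orP[] /eqP ->.
rewrite aC bC => ->.
rewrite big_setU1 ?inE//= big_set1 aC bC -!preimage_entry_part.
by rewrite !entry_part_law// EFinM !fineK ?fin_num_measure.
Qed.

Lemma rintegrable_entry_part a : rintegrable P (entry_part a).
Proof.
exact: (integrable_law (measurable_entry_part a) (entry_part_law a)
  integrable_half_normal).
Qed.

Lemma mean_entry_part a : mean P (entry_part a) = 0.
Proof.
rewrite meanE.
rewrite (integral_law (measurable_entry_part a) (entry_part_law a) (f := EFin)).
  by rewrite integral_half_normal.
exact: integrable_half_normal.
Qed.

Let measurable_pair a b : measurable_fun setT
  (fun w => (entry_part a w, entry_part b w)
            : measurableTypeR R * measurableTypeR R).
Proof. by apply: measurable_fun_pair; exact: measurable_entry_part. Qed.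

Lemma rintegrable_entry_part_prod a b :
  rintegrable P (fun w => entry_part a w * entry_part b w).
Proof.
have [<-|ab] := eqVneq a b.
  exact: (integrable_law (measurable_entry_part a) (entry_part_law a)
    integrable_half_normal_sqr).
exact: (integrable_law (measurable_pair a b)
  (fun A => @entry_part_pair_law a b A ab) integrable_half_normal_prod).
Qed.

Lemma mean_entry_part_prod a b :
  mean P (fun w => entry_part a w * entry_part b w) = (a == b)%:R * 2^-1.
Proof.
rewrite meanE; have [<-|ab] := eqVneq a b.
  rewrite (integral_law (measurable_entry_part a) (entry_part_law a)
    (f := fun x => (x * x)%:E)); last exact: integrable_half_normal_sqr.
  rewrite mul1r -[RHS]/(fine (2^-1)%:E) -integral_half_normal_sqr.
  by congr fine; apply: eq_integral => x _; rewrite expr2.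
rewrite (integral_law (measurable_pair a b)
  (fun A => @entry_part_pair_law a b A ab) (f := fun z => (z.1 * z.2)%:E)).
  by rewrite integral_half_normal_prod mul0r.
exact: integrable_half_normal_prod.
Qed.

(** The real and the imaginary part are each affine in the [entry_part] family, and injectivity of
    [e] keeps the selected parts orthogonal. *)
Lemma mean_sqnormc_affine (J : finType) (e : J -> 'I_m * 'I_n)
    (D : R[i]) (c : J -> R[i]) : injective e ->
  mean P (fun w => sqnormc (D + \sum_j c j * W w (e j).1 (e j).2)) =
  sqnormc D + \sum_j sqnormc (c j).
Proof.
move=> e_inj.
pose E (a : J * bool) : idx := (e a.1, a.2).
have E_inj : injective E.
  move=> [i b] [j b'] Eij.
  congr (_, _); last exact: (congr1 snd Eij).
  by apply: e_inj; exact: (congr1 fst Eij).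
pose cRe (a : J * bool) :=
  if a.2 then - complex.Im (c a.1) else complex.Re (c a.1).
pose cIm (a : J * bool) :=
  if a.2 then complex.Re (c a.1) else complex.Im (c a.1).
have pair_bool (F : J * bool -> R) :
    \sum_a F a = \sum_j (F (j, false) + F (j, true)).
  transitivity (\sum_j \sum_b F (j, b)).
    by rewrite pair_bigA; apply: eq_bigr => -[].
  by apply: eq_bigr => j _; rewrite big_bool addrC.
have ReE w : complex.Re (D + \sum_j c j * W w (e j).1 (e j).2) =
    complex.Re D + \sum_a cRe a * entry_part (E a) w.
  rewrite raddfD raddf_sum pair_bool; congr (_ + _); apply: eq_bigr => j _.
  by rewrite /= complex_ReM /cRe /entry_part/= mulNr.
have ImE w : complex.Im (D + \sum_j c j * W w (e j).1 (e j).2) =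
    complex.Im D + \sum_a cIm a * entry_part (E a) w.
  rewrite raddfD raddf_sum pair_bool; congr (_ + _); apply: eq_bigr => j _.
  by rewrite /= complex_ImM /cIm /entry_part/= addrC.
have i1 a := rintegrable_entry_part (E a).
have m0 a := mean_entry_part (E a).
have i2 a b := rintegrable_entry_part_prod (E a) (E b).
have m2 a b : mean P (fun w => entry_part (E a) w * entry_part (E b) w) =
    (a == b)%:R * 2^-1.
  by rewrite mean_entry_part_prod (inj_eq E_inj).
under [X in mean _ X]eq_fun do rewrite sqnormcE ReE ImE.
rewrite meanD; [|exact: rintegrable_sqr_affine..].
rewrite !(mean_sqr_affine i1 m0 i2 m2).
(* Each [sqnormc (c j)] occurs twice, once through [cRe] and once through [cIm], with weight 1/2. *)
rewrite addrACA -sqnormcE; congr (_ + _); rewrite -mulrDr !pair_bool -big_split.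
rewrite mulr_sumr; apply: eq_bigr => j _; rewrite /cRe /cIm/= sqnormcE; lra.
Qed.

End ComplexNormalEntries.

(** * The cascaded channel and the near-field interference power *)

Section FarChannel.
Context {R : realType} (p : system R).
Implicit Types (s : 'I_(nsub p)) (a : 'I_(Mstar p)) (k : 'I_(Kf p)).

(** Euclidean division by [Mstar p] recovers the subarray and the position in it; the divisor is
    positive because [a] inhabits its ordinal. *)
Lemma antenna_inj :
  injective (fun sa : 'I_(nsub p) * 'I_(Mstar p) => antenna sa.1 sa.2).
Proof.
move=> [s a] [s' a'] /(congr1 (@nat_of_ord _)) /= E.
have M0 : (0 < Mstar p)%N by exact: leq_ltn_trans (ltn_ord a).
have Es : s = s' :> nat.
  have := congr1 (fun x => x %/ Mstar p)%N E.
  by rewrite !divnMDl// !divn_small ?ltn_ord// !addn0.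
have Ea : a = a' :> nat.
  by apply/eqP; rewrite -(eqn_add2l (s * Mstar p)) {2}Es E.
by congr (_, _); apply: val_inj.
Qed.

Definition ris_row k : 'rV[R[i]]_(N p) := (ris_user k) ^t* *m Theta p.

Lemma sqnormc_planar_steering (n1 n2 : nat) (az el : R) i :
  sqnormc (@planar_steering R p n1 n2 az el i 0) = 1.
Proof. by rewrite !mxE sqnormcM !sqnormc_cis mulr1. Qed.

(** Steering entries and RIS phases have modulus 1, so only the path gain is left. *)
Lemma sqnormc_ris_row k n : sqnormc (ris_row k 0 n) = varsigma k.
Proof.
rewrite /ris_row mul_mx_diag mxE sqnormcM [X in _ * sqnormc X]mxE sqnormc_cis.
rewrite mulr1 mxE sqnormc_conj mxE /ris_user mxE sqnormcM sqnormc_real.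
rewrite sqnormc_planar_steering mulr1.
by rewrite sqr_sqrtr// ltW// varsigma_gt0.
Qed.

Lemma far_channelC H s k :
  (far_channel H s k) ^t* = ris_row k *m subarray_cols (H2 H) s.
Proof. by rewrite /far_channel trmxCK. Qed.

Definition los_gain k s (v : 'cV[R[i]]_(Mstar p)) : R[i] :=
  (ris_row k *m subarray_cols (H2bar p) s *m v) 0 0.

(** Separates a constant from a linear form in the entries of [H], as [mean_sqnormc_affine]
    requires. *)
Lemma far_gainE H s k (v : 'cV[R[i]]_(Mstar p)) :
  ((far_channel H s k) ^t* *m v) 0 0 =
  (alpha2 p)%:C * los_gain k s v +
  \sum_n \sum_a (beta2 p)%:C * ris_row k 0 n * v a 0 * H n (antenna s a).
Proof.
rewrite far_channelC /subarray_cols /H2.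
rewrite (_ : colsub _ _ = (alpha2 p)%:C *: colsub (antenna s) (H2bar p) +
  (beta2 p)%:C *: colsub (antenna s) H); last first.
  by apply/matrixP => i j; rewrite !mxE.
rewrite mulmxDr mulmxDl -!scalemxAr -!scalemxAl !mxE; congr (_ * _ + _).
  by rewrite /los_gain [RHS]mxE.
rewrite [RHS]exchange_big mulr_sumr; apply: eq_bigr => a _.
rewrite mxE mulr_suml mulr_sumr; apply: eq_bigr => n _.
rewrite [colsub _ _ _ _]mxE; ring.
Qed.

(** [Mkk k] is the conjugate transpose of [ris_row k] times [ris_row k], so its form factors into
    two line-of-sight gains. *)
Lemma los_quadratic_form k s s' (v v' : 'cV[R[i]]_(Mstar p)) :
  complex.Re ((v' ^t* *m Bmx k s s' *m v) 0 0) =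
  complex.Re (((alpha2 p)%:C * los_gain k s' v')^*%R *
              ((alpha2 p)%:C * los_gain k s v)) +
  (s == s')%:R * varsigma k * beta2 p ^+ 2 * (N p)%:R *
    complex.Re ((v' ^t* *m v) 0 0).
Proof.
rewrite /Bmx mulmxDr mulmxDl mxE raddfD; congr (_ + _); last first.
  by rewrite mul_mx_scalar -scalemxAl mxE /= complex_ReZ.
rewrite -scalemxAr -scalemxAl mxE.
have -> : v' ^t* *m ((subarray_cols (H2bar p) s') ^t* *m Mkk k *m
      subarray_cols (H2bar p) s) *m v =
    (ris_row k *m subarray_cols (H2bar p) s' *m v') ^t* *m
    (ris_row k *m subarray_cols (H2bar p) s *m v).
  by rewrite /Mkk /ris_row !trmxC_mul trmxCK !mulmxA.
rewrite mulmxtC11 -/(los_gain k s v) -/(los_gain k s' v') conj_realM mulrACA.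
by rewrite -rmorphM -expr2.
Qed.

(* The deterministic and the Rayleigh part of the cascaded channel are made a
   constant plus a combination of distinct entries of [W]; distinctness is
   [antenna_inj], and gives the Kronecker delta of [Bmx]. *)
Lemma mean_near_interference {d : measure_display} {T : measurableType d}
    (P : probability T R) (W : T -> 'M[R[i]]_(N p, M p)) k
    (S : {set 'I_(nsub p)}) (q : 'I_(nsub p) -> R)
    (v : 'I_(nsub p) -> 'cV[R[i]]_(Mstar p)) :
  iid_std_complex_normal P W ->
  mean P (fun w => sqnormc (\sum_(s in S) (q s)%:C *
    ((far_channel (W w) s k) ^t* *m v s) 0 0)) =
  \sum_(s in S) \sum_(s' in S) q s * q s' *
    complex.Re (((v s') ^t* *m Bmx k s s' *m v s) 0 0).
Proof.
move=> Wiid.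
pose x s := (q s)%:C * ((alpha2 p)%:C * los_gain k s (v s)).
pose e (j : 'I_(N p) * ('I_(nsub p) * 'I_(Mstar p))) :=
  (j.1, antenna j.2.1 j.2.2).
have e_inj : injective e.
  move=> [n sa] [n' sa'] Ee; congr (_, _); first exact: (congr1 fst Ee).
  by apply: antenna_inj; exact: (congr1 snd Ee).
(* Weights extended by 0 outside [S], so that the sum runs over the whole index type. *)
pose q' s := if s \in S then q s else 0.
pose c (j : 'I_(N p) * ('I_(nsub p) * 'I_(Mstar p))) :=
  (q' j.2.1)%:C * ((beta2 p)%:C * ris_row k 0 j.1 * v j.2.1 j.2.2 0).
have -> : (fun w => sqnormc (\sum_(s in S) (q s)%:C *
    ((far_channel (W w) s k) ^t* *m v s) 0 0)) =
    (fun w => sqnormc (\sum_(s in S) x s +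
      \sum_j c j * W w (e j).1 (e j).2)).
  apply/funext => w; congr sqnormc.
  under eq_bigr do rewrite far_gainE mulrDr.
  rewrite big_split /=; congr (_ + _).
  rewrite -(pair_bigA _ (fun n sa => c (n, sa) * W w n (antenna sa.1 sa.2)))/=.
  rewrite exchange_big/= -(pair_bigA _ (fun s a =>
    \sum_n c (n, (s, a)) * W w n (antenna s a)))/=.
  rewrite big_mkcond/=; apply: eq_bigr => s _; rewrite /c /q' /=.
  case: ifP => _; last first.
    by rewrite big1// => a _; rewrite big1// => n _; rewrite !mul0r.
  rewrite exchange_big mulr_sumr; apply: eq_bigr => a _.
  by rewrite mulr_sumr; apply: eq_bigr => n _; rewrite mulrA.
rewrite (mean_sqnormc_affine Wiid _ _ e_inj).
have cE : \sum_j sqnormc (c j) = \sum_(s in S) q s ^+ 2 *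
    (varsigma k * beta2 p ^+ 2 * (N p)%:R *
     complex.Re (((v s) ^t* *m v s) 0 0)).
  rewrite -(pair_bigA _ (fun n sa => sqnormc (c (n, sa))))/= exchange_big/=.
  rewrite -(pair_bigA _ (fun s a => \sum_n sqnormc (c (n, (s, a)))))/=.
  rewrite [RHS]big_mkcond/=; apply: eq_bigr => s _; rewrite /c /q' /=.
  case: ifP => _; last first.
    rewrite big1// => a _; rewrite big1// => n _.
    by rewrite sqnormcM sqnormc_real expr0n mul0r.
  rewrite [in RHS]mxE raddf_sum !mulr_sumr; apply: eq_bigr => a _.
  rewrite !mxE /= Re_conjM.
  under eq_bigr do rewrite !sqnormcM !sqnormc_real sqnormc_ris_row.
  (* The summand no longer depends on the RIS element; summing over the elements yields the factor
     [N p]. *)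
  rewrite sumr_const card_ord -mulr_natr; ring.
rewrite cE {cE} sqnormc_sum_in -big_split; apply: eq_bigr => s sS /=.
under [RHS]eq_bigr do rewrite los_quadratic_form mulrDr.
rewrite big_split; congr (_ + _) => /=.
  apply: eq_bigr => s' _; rewrite /x conj_realM mulrACA -rmorphM.
  by rewrite complex_ReZ [q s' * _]mulrC.
(* The Kronecker delta keeps only [s' = s]. *)
rewrite (bigD1 s)//= eqxx mul1r big1 ?addr0.
  by rewrite expr2.
by move=> s' /andP[_ s's]; rewrite eq_sym (negbTE s's) !mul0r mulr0.
Qed.

End FarChannel.

(** * The unit gain of zero forcing *)

Section ZeroForcing.
Context {R : realType} (p : system R).
Variables (H : 'M[R[i]]_(N p, M p)) (k : 'I_(Kf p)).

(** This is the diagonal entry [j] of the Gram matrix times its inverse. *)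
Lemma zf_gain (m n : nat) (G : 'M[R[i]]_(m, n)) (j : 'I_n) :
  G ^t* *m G \in unitmx -> ((col j G) ^t* *m col j (zf G)) 0 0 = 1.
Proof.
move=> Gu; rewrite /zf tr_col map_row -row_mul colE mulmxA -colE.
by rewrite mulmxA mulmxV// !mxE eqxx.
Qed.

(** [not_alone] excludes the MRT branch of [lzf_far], leaving [zf_gain]. *)
Lemma lzf_far_gain s : s \in Sfar k -> not_alone k ->
  (far_matrix H s) ^t* *m far_matrix H s \in unitmx ->
  ((far_channel H s k) ^t* *m lzf_far H s k) 0 0 = 1.
Proof.
move=> sk /(_ s sk) served Gu; rewrite /lzf_far gtn_eqF//= -(zf_gain k Gu).
by congr ((_ ^t* *m _) 0 0); apply/matrixP => a j; rewrite !mxE ord1.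
Qed.

End ZeroForcing.

Theorem proposition6 (R : realType) (d : measure_display)
  (T : measurableType d) (P : probability T R) (p : system R)
  (H2tilde : T -> 'M[R[i]]_(N p, M p))
  (H2tilde_iid : iid_std_complex_normal P H2tilde)
  (near_inv : forall s : 'I_(nsub p),
     (near_matrix s) ^t* *m near_matrix s \in unitmx)
  (far_inv : forall s : 'I_(nsub p),
     {ae P, forall w, (far_matrix (H2tilde w) s) ^t*
                       *m far_matrix (H2tilde w) s \in unitmx})
  (k : 'I_(Kf p))
  (fin_exp : finite_expectations P H2tilde (@lzf_near R p)
               (fun w => lzf_far (H2tilde w)) k)
  (k_not_alone : not_alone k) :
  let Delta :=
    Pf p * \sum_(j | j != k)
      mean P (fun w => sqnormc
        (\sum_(s in Sfar j) (Num.sqrt (eta_far s j))%:C *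
           ((far_channel (H2tilde w) s k) ^t* *m lzf_far (H2tilde w) s j) 0 0))
    + Pn p * \sum_(i < Kn p) \sum_(s in Snear i) \sum_(s' in Snear i)
        Num.sqrt (eta_near s i * eta_near s' i) * tau_near k i s s' in
  SE P H2tilde (@lzf_near R p) (fun w => lzf_far (H2tilde w)) k =
  log2 (1 + Pf p * (\sum_(s in Sfar k) Num.sqrt (eta_far s k)) ^+ 2
            / (Delta + sigma2 k)).
Proof.
move=> Delta.
have Pf0 := Pf_gt0 p; have Pn0 := Pn_gt0 p.
have [[iRe iIm] iBU iUIF iUIN] := fin_exp.
pose c := \sum_(s in Sfar k) Num.sqrt (eta_far s k).
have signalE : {ae P, forall w, far_signal H2tilde
    (fun w => lzf_far (H2tilde w)) k k w = c%:C}.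
  (* There are finitely many subarrays, so almost surely all Gram matrices are invertible at
     once. *)
  apply: filterS (filter_forall (ae_filter_ringOfSetsType P) far_inv) => w Gu.
  rewrite /far_signal /c rmorph_sum.
  by apply: eq_bigr => s sk; rewrite /gain lzf_far_gain// mulr1.
have cmeanE : cmean P (far_signal H2tilde
    (fun w => lzf_far (H2tilde w)) k k) = c%:C.
  rewrite /cmean (ae_eq_mean (g := fun=> c) iRe)//; last first.
    by apply: filterS signalE => w ->.
  rewrite (ae_eq_mean (g := fun=> 0) iIm)//; last first.
    by apply: filterS signalE => w ->.
  by rewrite !mean_cst.
have BU0 : mean P (fun w => sqnormc (BU P H2tilde
    (fun w => lzf_far (H2tilde w)) k w)) = 0.
  rewrite (ae_eq_mean (g := fun=> 0) iBU) ?mean_cst//.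
  apply: filterS signalE => w sE; rewrite /BU cmeanE sE subrr mulr0.
  by rewrite sqnormcE !raddf0 expr0n addr0.
rewrite /SE /SINR BU0 add0r; congr (log2 (1 + _ / _)).
  by rewrite /DS cmeanE sqnormc_sqrtM ?ltW// sqnormc_real.
congr (_ + _); rewrite /Delta mulr_sumr; congr (_ + _).
  apply: eq_bigr => j jk.
  (* The power leaves the mean once integrability of the unscaled term is recovered, [Pf p] being
     nonzero. *)
  have := iUIF j jk; rewrite /UIF.
  under [X in rintegrable _ X -> _]eq_fun do rewrite sqnormc_sqrtM ?ltW//.
  under [X in _ -> mean _ X = _]eq_fun do rewrite sqnormc_sqrtM ?ltW//.
  by move=> /(rintegrableZl_inv (lt0r_neq0 Pf0)) /meanZl ->.
rewrite mulr_sumr; apply: eq_bigr => i _.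
have := iUIN i; rewrite /UIN.
under [X in rintegrable _ X -> _]eq_fun do rewrite sqnormc_sqrtM ?ltW//.
under [X in _ -> mean _ X = _]eq_fun do rewrite sqnormc_sqrtM ?ltW//.
move=> /(rintegrableZl_inv (lt0r_neq0 Pn0)) /meanZl ->; congr (_ * _).
(* The weights [q] are the square roots of [eta_near]; their product is the square root of the
   product. *)
rewrite mean_near_interference//; apply: eq_bigr => s _; apply: eq_bigr => s' _.
by rewrite /tau_near sqrtrM// eta_near_ge0.
Qed.
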